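(* Let $p$ be a prime number, let $k$ be a natural number with $2^{k}<p$, and let $(A,+,\circ)$ be an $\mathbb{F}_{p}$-brace which is strongly nilpotent of degree $k$. Write $a*b=a\circ b-a-b$, and define a binary operation $\cdot$ on $A$ by $$a\cdot b=\sum_{i=0}^{p-2}\frac{1}{2^{i}}\bigl((2^{i}a)*b\bigr)\qquad (a,b\in A),$$ where $2^{i}a$ denotes the sum of $2^{i}$ copies of $a$ and $\frac1{2^{i}}$ denotes the inverse of $2^{i}$ in $\mathbb{F}_{p}$. Then $$(a\cdot b)\cdot c-a\cdot(b\cdot c)=(b\cdot a)\cdot c-b\cdot(a\cdot c)$$ for all $a,b,c\in A$.
   Context: A left brace is a set $A$ with operations $+,\circ$ such that $(A,+)$ is an abelian group, $(A,\circ)$ is a group, and $a\circ(b+c)+a=a\circ b+a\circ c$ for all $a,b,c\in A$. One writes $a*b=a\circ b-a-b$. For a field $\mathbb{F}$, an $\mathbb{F}$-brace is a left brace whose additive group is an $\mathbb{F}$-vector space with $a*(\alpha b)=\alpha(a*b)$ for all $a,b\in A$, $\alpha\in\mathbb{F}$. $\mathbb{F}_p$ is the field with $p$ elements. For subsets $X,Y\subseteq A$, $X*Y$ denotes the set of all finite sums of elements $x*y$, $x\in X$, $y\in Y$. Put $A^{[1]}=A$ and $A^{[i+1]}=\sum_{j=1}^{i}A^{[j]}*A^{[i+1-j]}$. The brace $A$ is strongly nilpotent if $A^{[n]}=0$ for some $n$; it is strongly nilpotent of degree $k$ (equivalently, has nilpotency index $k$) if $A^{[k]}=0$ and $A^{[k-1]}\neq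 0$. *)

(* Defs.v *)
From HB Require Import structures.
From mathcomp Require Import all_boot all_algebra.
From mathcomp Require Import classical_sets.

Set Implicit Arguments.
Unset Strict Implicit.
Unset Printing Implicit Defensive.

Import GRing.Theory.
Local Open Scope classical_set_scope.
Local Open Scope ring_scope.

(* The group structure [(A, \circ)] is the multiplicative structure of a
   [groupType], i.e. [circ] is [*%g], independent of the additive one. *)
Definition circ (A : groupType) (a b : A) : A := (a * b)%g.
Arguments circ {A} (a b)%_ring_scope.

Notation "a ∘ b" := (circ a b) (at level 40, left associativity) : ring_scope.

HB.mixin Record Zmodule_Group_isLeftBrace A of GRing.Zmodule A & Group A := {
  brace_axiom : forall a b c : A, a ∘ (b + c) + a = a ∘ b + a ∘ c
}.

#[short(type="leftBraceType")]
HB.structure Definition LeftBrace :=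
  {A of GRing.Zmodule A & Group A & Zmodule_Group_isLeftBrace A}.

Definition star (A : leftBraceType) (a b : A) : A := a ∘ b - a - b.

Notation "a ⋆ b" := (star a b) (at level 40, left associativity) : ring_scope.

HB.mixin Record LeftBrace_isFBrace (F : fieldType) A
    of LeftBrace A & GRing.Lmodule F A := {
  brace_scaler : forall (x : F) (a b : A), a ⋆ (x *: b) = x *: (a ⋆ b)
}.

#[short(type="fbraceType")]
HB.structure Definition FBrace (F : fieldType) :=
  {A of LeftBrace A & GRing.Lmodule F A & LeftBrace_isFBrace F A}.

Section StrongNilpotency.
Variable A : leftBraceType.

Definition set_star (X Y : set A) : set A :=
  [set z | exists s : seq (A * A),
     (forall xy, xy \in s -> X xy.1 /\ Y xy.2) /\
     z = \sum_(xy <- s) xy.1 ⋆ xy.2].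

Definition set_sum (m n : nat) (X : nat -> set A) : set A :=
  [set z | exists x : nat -> A,
     (forall j, (m <= j < n)%N -> X j (x j)) /\ z = \sum_(m <= j < n) x j].

(* [strong_pows n] is the sequence A^[1], ..., A^[n]; the set A^[j] is thus
   its item of index [j.-1]. *)
Fixpoint strong_pows (n : nat) : seq (set A) :=
  if n is i.+1 then
    let s := strong_pows i in
    let P j := nth setT s j.-1 in
    rcons s (if i is 0 then setT
             else set_sum 1 i.+1 (fun j => set_star (P j) (P (i.+1 - j)%N)))
  else [::].

(* A^[n], for n >= 1; [strong_pow 0] is a dummy value. The characteristic
   equations are [strong_pow1] and [strong_powS] below. *)
Definition strong_pow (n : nat) : set A := nth setT (strong_pows n) n.-1.

Lemma size_strong_pows n : size (strong_pows n) = n.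
Proof. by elim: n => //= n IHn; rewrite size_rcons IHn. Qed.

Lemma nth_strong_pows n j :
  (0 < j <= n)%N -> nth setT (strong_pows n) j.-1 = strong_pow j.
Proof.
case/andP=> j_gt0; elim: n => [|n IHn]; first by case: j j_gt0.
rewrite leq_eqVlt => /orP[/eqP-> //|]; rewrite ltnS => le_jn.
by rewrite /= nth_rcons size_strong_pows prednK // le_jn IHn.
Qed.

Lemma strong_pow1 : strong_pow 1 = setT.
Proof. by []. Qed.

Lemma strong_powS i : (0 < i)%N ->
  strong_pow i.+1 =
    set_sum 1 i.+1
      (fun j => set_star (strong_pow j) (strong_pow (i.+1 - j)%N)).
Proof.
case: i => // i _; rewrite {1}/strong_pow.
rewrite [strong_pows _]/= -[rcons (strong_pows i) _]/(strong_pows i.+1).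
rewrite nth_rcons size_strong_pows ltnn eqxx.
have E j : (1 <= j < i.+2)%N ->
  set_star (nth setT (strong_pows i.+1) j.-1)
           (nth setT (strong_pows i.+1) (i.+2 - j).-1)
  = set_star (strong_pow j) (strong_pow (i.+2 - j)%N).
  case/andP=> j_gt0 lt_j; rewrite !nth_strong_pows ?j_gt0 //.
  by rewrite subn_gt0 lt_j leq_subLR -addn1 addnC leq_add2r.
by apply/seteqP; split=> z -[x [Px ->]]; exists x; split=> // j jP;
  have := Px j jP; rewrite E.
Qed.

(* When [k = 1] (the zero brace) there is no A^[k-1] to consider. *)
Definition strongly_nilpotent_of_degree (k : nat) : Prop :=
  [/\ (0 < k)%N, strong_pow k = [set 0]
    & ((1 < k)%N -> strong_pow k.-1 <> [set 0])].

End StrongNilpotency.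

Definition prelie_mul (p : nat) (A : fbraceType 'F_p) (a b : A) : A :=
  \sum_(0 <= i < p.-1) ((2 ^ i)%:R : 'F_p)^-1 *: ((a *+ 2 ^ i) ⋆ b).

Notation "a ⊙ b" := (prelie_mul a b) (at level 40, left associativity)
  : ring_scope.

(* Main.v *)
Require Import Defs.
From mathcomp Require Import all_boot all_algebra.
From mathcomp Require Import boolp.

(** The product [a ⊙ b] extracts from [t |-> (t a) ⋆ b] its component of degree
    1 in [t], up to sign: for a polynomial map [F] of degree less than [k],
    the operator [L F (x) = \sum_(i < p - 1) 2^-i F (2^i x)], here [lin_part],
    multiplies the homogeneous component of degree [j] by
    [\sum_i 2^(i (j - 1))], which is [-1] for [j = 1] and is [0] for the other
    [j < k], because [2^(j - 1)] is not [1] modulo [p] when [2^k < p].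

    To use this without multivariate polynomials, polynomial maps are described
    by their finite differences. Two facts carry the proof.

    - Degree. Every expression built from additive maps and constants with [+]
      and [⋆] is polynomial of degree less than [k]. More precisely, call [F] of
      weight [n] when its differences of order [j] take values in [A^[n + j]];
      weights add up under [⋆] ([polymap_inv_star]). Since [A^[k]] vanishes,
      so do the differences of order [k].
    - Linearity. [L F] is additive when [F] has degree less than [k]
      ([lin_part_additive]). Indeed [L F (2 x) = 2 L F (x)] holds for every [F],
      while [G (2 x) - 2^d G (x)] has degree less than [d] if [G] has degree at
      most [d]; hence [(2 - 2^d) L F] has degree less than [d], and the
      degree of [L F] drops down to 1.

    Let [x ▷ y] be the value at [y] of [L] applied to [z |-> (x + z) ⋆ c], that
    is, up to sign, the derivative of [⋆ c] at [x] in the direction [y]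
    ([dstar]). It is additive in [y], and [0 ▷ y = y ⊙ c]. Applying [L] in the
    variable [y] to the identity
      [(x + y + x ⋆ y) ⋆ c = x ⋆ c + y ⋆ c + x ⋆ (y ⋆ c)],
    whose left hand side depends on [y] through [x + (y + x ⋆ y)], gives
      [x ▷ b + x ▷ (x ⋆ b) = b ⊙ c + x ⋆ (b ⊙ c)].
    Then apply [L] in the variable [x], at [a]. The constant disappears, and
    [x ▷ (x ⋆ b)] may be replaced by [0 ▷ (x ⋆ b)], since their difference is
    of order at least 2 in [x]. With [S a b] the image of [x ▷ b], this reads
      [S a b + (a ⊙ b) ⊙ c = a ⊙ (b ⊙ c)].
    Finally [S a b] is the component of bidegree [(1, 1)] of
    [(s a + t b) ⋆ c], which is symmetric in [a] and [b]. *)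
Set Implicit Arguments.
Unset Strict Implicit.
Unset Printing Implicit Defensive.

Import GRing.Theory.
Local Open Scope ring_scope.

(** * Left braces and their strong powers *)

Section LeftBrace.
Variable A : leftBraceType.
Implicit Types a b c : A.

Lemma circE a b : a ∘ b = a + b + a ⋆ b.
Proof. by rewrite /star [RHS]addrC -[X in _ = X + _]addrA -opprD subrK. Qed.

Lemma starDr a b c : a ⋆ (b + c) = a ⋆ b + a ⋆ c.
Proof.
rewrite /star; have /(canRL (addrK a)) -> := brace_axiom a b c.
by rewrite opprD [RHS]addrACA [X in _ = X + _]addrACA !addrA.
Qed.

Lemma star0r a : a ⋆ 0 = 0.
Proof. by apply: (addIr (a ⋆ 0)); rewrite -starDr !add0r. Qed.

Lemma starNr a b : a ⋆ (- b) = - (a ⋆ b).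
Proof. by apply: (addIr (a ⋆ b)); rewrite -starDr !addNr star0r. Qed.

Lemma starMnr a b n : a ⋆ (b *+ n) = (a ⋆ b) *+ n.
Proof.
by elim: n => [|n IHn]; rewrite ?mulr0n ?star0r // !mulrS starDr IHn.
Qed.

(** Both groups share their neutral element, as [1 ∘ 0 = 1 + 0 + 1 ⋆ 0 = 1]. *)
Lemma one_brace : (1%g : A) = 0.
Proof.
have := circE 1%g 0; rewrite star0r !addr0 => <-.
by rewrite /circ mul1g.
Qed.

Lemma star0l a : 0 ⋆ a = 0.
Proof.
apply: (addrI (0 + a)); rewrite -circE -[X in X ∘ a]one_brace /circ mul1g.
by rewrite add0r addr0.
Qed.

(** This is associativity of [∘]: the maps [c |-> c + a ⋆ c] compose like the
    elements [a]. *)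
Lemma circ_starl a b c : (a ∘ b) ⋆ c = a ⋆ c + b ⋆ c + a ⋆ (b ⋆ c).
Proof.
have : (a ∘ b) ∘ c = a ∘ (b ∘ c) by rewrite /circ mulgA.
rewrite [LHS]circE [RHS]circE [b ∘ c]circE.
rewrite (starDr a (b + c)) (starDr a b c) [X in X + _ + _]circE => H.
apply: (addrI (a + b + a ⋆ b + c)); rewrite H {H}.
(* The products themselves unfold to sums, which [addrA] must not see. *)
move: (a ⋆ b) (a ⋆ c) (b ⋆ c) (a ⋆ (b ⋆ c)) => t v s u.
by rewrite !addrA [LHS](ACl (1*2*5*3*6*4*7)).
Qed.

(** The correction term lies deeper in the filtration than [a]. *)
Lemma inv_braceE a : (a^-1)%g = - a - a ⋆ (a^-1)%g.
Proof.
have := circE a (a^-1)%g; rewrite {1}/circ mulgV one_brace => /esym.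
rewrite [X in X = _]addrAC [X in X = _]addrC => /eqP.
by rewrite addr_eq0 -opprD => /eqP.
Qed.

(** The quotient of [b] by [a] in the group [(A, ∘)] is a function of their
    difference [b - a] of no smaller weight. *)
Lemma circ_quotient a b : (a^-1)%g ∘ b = b - a + (a^-1)%g ⋆ (b - a).
Proof.
have := circE (a^-1)%g a; rewrite {1}/circ mulVg one_brace => /esym/eqP.
rewrite addrC addr_eq0 => /eqP starVa.
rewrite circE (starDr _ b) starNr starVa opprK.
move: (a^-1)%g ((a^-1)%g ⋆ b) => v u.
by rewrite -[LHS](addrK a) !addrA [RHS](ACl (4*1*3*5*2)).
Qed.

(** Index 0 stands for one more copy of [A] at the start of the filtration:
    the identity map then has weight 0, its differences lying in [A^[1]]. *)
Lemma strong_pow_full n a : (n <= 1)%N -> strong_pow n a.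
Proof. by case: n => [|[|]]. Qed.

(** Opposites are taken in the right factor, where [⋆] is additive; this is why
    the induction is over all smaller powers at once. *)
Lemma strong_pow_closed n :
  strong_pow n (0 : A) /\
  (forall a b : A, strong_pow n a -> strong_pow n b -> strong_pow n (a - b)).
Proof.
elim/ltn_ind: n => -[|[|n]] IHn; do ?by split.
rewrite strong_powS //; split=> [|_ _ [x [Px ->]] [y [Py ->]]].
  exists (fun=> 0); split=> [j _|]; last by rewrite big1.
  by exists [::]; split=> //; rewrite big_nil.
exists (fun j => x j - y j); split=> [j jP|]; last by rewrite sumrB.
have [s [Ps ->]] := Px j jP; have [t [Pt ->]] := Py j jP.
exists (s ++ [seq (uv.1, - uv.2) | uv <- t]); split=> [uv|].
  rewrite mem_cat => /orP[/Ps//|/mapP[{}uv /Pt[Puv Quv] ->]]; split=> //=.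
  have [|F0 FB] := IHn (n.+2 - j)%N; last by rewrite -[- _]add0r; apply: FB.
  by case/andP: jP => j_gt0 _; rewrite ltn_subrL j_gt0.
rewrite big_cat big_map -sumrN; congr (_ + _); apply: eq_bigr => uv _ /=.
by rewrite starNr.
Qed.

Lemma strong_pow0 n : strong_pow n (0 : A).
Proof. by case: (strong_pow_closed n). Qed.

Lemma strong_powB n a b :
  strong_pow n a -> strong_pow n b -> strong_pow n (a - b).
Proof. by case: (strong_pow_closed n) => _; apply. Qed.

Lemma strong_powN n a : strong_pow n a -> strong_pow n (- a).
Proof. by rewrite -sub0r; apply/strong_powB/strong_pow0. Qed.

Lemma strong_powD n a b :
  strong_pow n a -> strong_pow n b -> strong_pow n (a + b).
Proof. by move=> Fa Fb; rewrite -[b]opprK; apply/strong_powB/strong_powN. Qed.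

Lemma strong_pow_ind n (P : A -> Prop) :
  P 0 -> (forall a b, P a -> P b -> P (a + b)) ->
  (forall j a b, (0 < j <= n.+1)%N -> strong_pow j a ->
     strong_pow (n.+2 - j) b -> P (a ⋆ b)) ->
  forall a, strong_pow n.+2 a -> P a.
Proof.
move=> P0 PD Pstar a; rewrite strong_powS // => -[x [Px ->]].
rewrite big_nat; elim/big_ind: _ => // j jP.
have [s [Ps ->]] := Px j jP; rewrite big_seq.
by elim/big_ind: _ => // uv /Ps[Pu Pv]; apply: Pstar Pu Pv.
Qed.

Lemma strong_pow_star_gt0 m n a b : (0 < m)%N -> (0 < n)%N ->
  strong_pow m a -> strong_pow n b -> strong_pow (m + n) (a ⋆ b).
Proof.
case: m n => [|m] [|n] // _ _ Fa Fb; rewrite addnS strong_powS //.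
have m_in : (1 <= m.+1 < (m.+1 + n).+1)%N by rewrite [(m.+1 < _)%N]ltnS leq_addr.
exists (fun j => if j == m.+1 then a ⋆ b else 0); split=> [j|].
  case: eqP => [-> _ | _ _]; last by exists [::]; split=> //; rewrite big_nil.
  exists [:: (a, b)]; split=> [uv|]; last by rewrite big_seq1.
  by rewrite inE => /eqP -> /=; rewrite -addnS addKn.
by rewrite -big_mkcond big_nat1_eq m_in.
Qed.

(** In [A^[j] ⋆ A^[n + 2 - j]] the right factor can be weakened, except for
    the last [j], where it is [A^[1]] and the left one is weakened instead. *)
Lemma strong_powSW n a : strong_pow n.+1 a -> strong_pow n a.
Proof.
elim/ltn_ind: n a => -[|[|n]] IHn a; do ?by move=> _; apply: strong_pow_full.
move: a; apply: strong_pow_ind => [|a b|j a b].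
- exact: strong_pow0.
- exact: strong_powD.
case/andP=> j_gt0; rewrite leq_eqVlt => /predU1P[->|lt_jn] Fa Fb.
  have -> : n.+2 = (n.+1 + 1)%N by rewrite addn1.
  apply: strong_pow_star_gt0; rewrite ?strong_pow_full //; exact: IHn.
rewrite -[n.+2](subnKC (ltnW lt_jn)).
apply: strong_pow_star_gt0; rewrite ?subn_gt0 //.
by apply: IHn; [rewrite ltn_subrL j_gt0 | rewrite -subSn // ltnW].
Qed.

Lemma strong_pow_star m n a b :
  strong_pow m a -> strong_pow n b -> strong_pow (m + n) (a ⋆ b).
Proof.
case: m n => [|m] [|n] Fa Fb; last exact: strong_pow_star_gt0.
- exact: strong_pow_full.
- by apply: strong_powSW; apply: (@strong_pow_star_gt0 1); rewrite ?strong_pow_full.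
- rewrite addn0; apply: strong_powSW; rewrite -addn1.
  by apply: strong_pow_star_gt0; rewrite ?strong_pow_full.
Qed.

Lemma strong_pow_inv n a : strong_pow n a -> strong_pow n (a^-1)%g.
Proof.
case: n => [|n] //= Fa; rewrite inv_braceE; apply: strong_powB.
  exact: strong_powN.
by apply: strong_powSW; rewrite -addn1; apply: strong_pow_star.
Qed.

End LeftBrace.

(** * Maps of bounded degree between abelian groups *)

Section FiniteDifferences.
Variables X V : zmodType.
Implicit Types (F G : X -> V) (h x : X).

Definition fdiff h F x : V := F (x + h) - F x.

Lemma fdiffD h F G :
  fdiff h (fun x => F x + G x) = fun x => fdiff h F x + fdiff h G x.
Proof. by apply/funext => x; rewrite /fdiff opprD addrACA. Qed.

Lemma fdiffMn h F n :
  fdiff h (fun x => F x *+ n) = fun x => fdiff h F x *+ n.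
Proof. by apply/funext => x; rewrite /fdiff mulrnBl. Qed.

Lemma fdiffN h F : fdiff h (fun x => - F x) = fun x => - fdiff h F x.
Proof. by apply/funext => x; rewrite /fdiff opprD. Qed.

Lemma fdiff_shift h F x : F (x + h) = F x + fdiff h F x.
Proof. by rewrite /fdiff addrCA subrr addr0. Qed.

(** [deg_lt d F] says that [F] is polynomial of degree less than [d] in the sense
    of Frechet: its differences of order [d] vanish. *)
Fixpoint deg_lt d F : Prop :=
  if d is d'.+1 then forall h, deg_lt d' (fdiff h F) else forall x, F x = 0.

Lemma deg_lt0 d : deg_lt d (fun=> 0).
Proof.
elim: d => //= d IHd h; have -> // : fdiff h (fun=> 0) = (fun=> 0).
by apply/funext => x; rewrite /fdiff subrr.
Qed.

Lemma deg_ltW d F : deg_lt d F -> deg_lt d.+1 F.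
Proof.
elim: d F => [F F0|d IHd F dF]; last by move=> h; apply/IHd/dF.
have -> : F = (fun=> 0) by apply/funext.
exact: deg_lt0.
Qed.

Lemma deg_ltD d F G :
  deg_lt d F -> deg_lt d G -> deg_lt d (fun x => F x + G x).
Proof.
elim: d F G => [F G F0 G0 x|d IHd F G dF dG h]; first by rewrite F0 G0 addr0.
by rewrite fdiffD; apply: IHd; [apply: dF | apply: dG].
Qed.

Lemma deg_lt_sum d n (F_ : nat -> X -> V) :
  (forall i, deg_lt d (F_ i)) -> deg_lt d (fun x => \sum_(0 <= i < n) F_ i x).
Proof.
move=> dF; elim: n => [|n IHn].
  by under eq_fun do rewrite big_nil; apply: deg_lt0.
by under eq_fun do rewrite big_nat_recr //=; apply: deg_ltD.
Qed.

Lemma deg_ltMn d F n : deg_lt d F -> deg_lt d (fun x => F x *+ n).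
Proof.
elim: d F => [F F0 x|d IHd F dF h]; first by rewrite F0 mul0rn.
by rewrite fdiffMn; apply: IHd.
Qed.

Lemma deg_lt_dilate d F n : deg_lt d F -> deg_lt d (fun x => F (x *+ n)).
Proof.
elim: d F => [F F0 x|d IHd F dF h]; first exact: F0.
have -> : fdiff h (fun x => F (x *+ n)) = fun x => fdiff (h *+ n) F (x *+ n).
  by apply/funext => x; rewrite /fdiff mulrnDl.
exact: IHd.
Qed.

(** A homogeneous component of degree [d] is multiplied by [2^d] under
    [x |-> 2 x]. In the induction, differencing produces the same expression for
    [fdiff h F] in degree [d], plus a second difference of [F], because a step of
    [2 h] is made of two steps of [h]. *)
Lemma deg_lt_dilate2 d F :
  deg_lt d.+1 F -> deg_lt d (fun x => F (x *+ 2) - F x *+ 2 ^ d).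
Proof.
elim: d F => [F dF x|d IHd F dF h].
  by rewrite mulr1n mulr2n; apply: dF.
have -> : fdiff h (fun x => F (x *+ 2) - F x *+ 2 ^ d.+1) =
  fun x => fdiff h (fdiff h F) (x *+ 2) +
           (fdiff h F (x *+ 2) - fdiff h F x *+ 2 ^ d) *+ 2.
  apply/funext=> x; rewrite expnSr /fdiff mulrnDl [h *+ 2]mulr2n addrA.
  move: (F (_ + h + h)) (F (_ *+ 2 + h)) (F (_ *+ 2)) (F x) (F (x + h)) => u v w t s.
  have -> (y z : V) : u - v - y + (y - z) *+ 2 = u - v + y - z *+ 2.
    by rewrite mulrnBl [y *+ 2]mulr2n !addrA subrK.
  rewrite addrA subrK -mulrnA.
  by rewrite mulrnBl !opprB !addrA [LHS](ACl (1*4*3*2)).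
apply: deg_ltD; first by apply: deg_lt_dilate; apply: dF.
by apply: deg_ltMn; apply: IHd; apply: dF.
Qed.

Lemma deg_lt2_additive F :
  deg_lt 2 F -> F 0 = 0 -> forall x y, F (x + y) = F x + F y.
Proof.
move=> dF F0 x y; have := dF x y 0; rewrite /fdiff !add0r F0 subr0.
by rewrite [y + x]addrC => /eqP; rewrite subr_eq0 subr_eq => /eqP.
Qed.

End FiniteDifferences.

(** * Polynomial maps adapted to the strong powers *)

Section PolynomialMaps.
Variables (A : leftBraceType) (X : zmodType).
Implicit Types (F G : X -> A) (m n r : nat).

(** [F] has weight [n] up to order [r]: for [j <= r], its differences of order [j]
    take values in [A^[n + j]]. Bounding the order by [r] allows induction on it
    for arbitrary weights. *)
Fixpoint polymap r n F : Prop :=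
  (forall x, strong_pow n (F x)) /\
  (if r is r'.+1 then forall h, polymap r' n.+1 (fdiff h F) else True).

Lemma polymap_val r n F : polymap r n F -> forall x, strong_pow n (F x).
Proof. by case: r => [|r] []. Qed.

Lemma polymap_fdiff r n F :
  polymap r.+1 n F -> forall h, polymap r n.+1 (fdiff h F).
Proof. by case. Qed.

Lemma polymapWr r n F : polymap r.+1 n F -> polymap r n F.
Proof.
elim: r n F => [|r IHr] n F [Fn dF]; split=> // h.
exact/IHr/dF.
Qed.

Lemma polymapWn r n F : polymap r n.+1 F -> polymap r n F.
Proof.
elim: r n F => [|r IHr] n F [Fn dF]; split=> //;
  try by move=> x; apply: strong_powSW.
by move=> h; apply/IHr/dF.
Qed.

Lemma polymap_leq r m n F : (m <= n)%N -> polymap r n F -> polymap r m F.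
Proof.
elim: n => [|n IHn]; rewrite leq_eqVlt => /predU1P[-> //|lt_mn] // /polymapWn.
exact: IHn.
Qed.

Lemma polymapD r n F G : polymap r n F -> polymap r n G ->
  polymap r n (fun x => F x + G x).
Proof.
elim: r n F G => [|r IHr] n F G [Fn dF] [Gn dG]; split=> //;
  try by move=> x; apply: strong_powD.
by move=> h; rewrite fdiffD; apply: IHr (dF h) (dG h).
Qed.

Lemma polymapN r n F : polymap r n F -> polymap r n (fun x => - F x).
Proof.
elim: r n F => [|r IHr] n F [Fn dF]; split=> //;
  try by move=> x; apply: strong_powN.
by move=> h; rewrite fdiffN; apply: IHr (dF h).
Qed.

Lemma polymap_cst r n a : strong_pow n a -> polymap r n (fun=> a).
Proof.
elim: r n a => [|r IHr] n a Fa; split=> // h.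
have -> : fdiff h (fun=> a) = (fun=> 0).
  by apply/funext => x; rewrite /fdiff subrr.
by apply: IHr; apply: strong_pow0.
Qed.

Lemma polymap_additive r F : {morph F : x y / x + y} -> polymap r 0 F.
Proof.
move=> FD; case: r => [|r]; split=> // h.
have -> : fdiff h F = (fun=> F h).
  by apply/funext => x; rewrite /fdiff FD addrC addKr.
by apply: polymap_cst; apply: strong_pow_full.
Qed.

Lemma polymapMn r n F j : polymap r n F -> polymap r n (fun x => F x *+ j).
Proof.
move=> rF; elim: j => [|j IHj].
  by apply: polymap_cst; apply: strong_pow0.
have -> : (fun x => F x *+ j.+1) = fun x => F x + F x *+ j.
  by apply/funext => x; rewrite mulrS.
exact: polymapD.
Qed.

(** Weights are preserved by inversion in [(A, ∘)] and add up under [⋆]. Both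
    are proved together, because a step from [x] to [x + h] is handled
    multiplicatively: [F (x + h) = F x ∘ E x], where [E] involves the inverse of
    [F] and is, like [fdiff h F], one weight deeper than [F]. The differences of
    [F^-1] and of [F ⋆ G] then expand into products that contain [E] or
    [fdiff h G], to which the case of order [r] applies. *)
Lemma polymap_inv_star r :
  (forall n F, polymap r n F -> polymap r n (fun x => (F x)^-1%g)) /\
  (forall m n F G, polymap r m F -> polymap r n G ->
     polymap r (m + n) (fun x => F x ⋆ G x)).
Proof.
elim: r => [|r [IHinv IHstar]].
  split=> [n F|m n F G] [Fn _]; first by split=> // x; apply: strong_pow_inv.
  by case=> Gn _; split=> // x; apply: strong_pow_star.
have quot n F h : polymap r.+1 n F ->
  exists2 E, polymap r n.+1 E & forall x, F (x + h) = F x ∘ E x.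
  move=> rF; exists (fun x => fdiff h F x + (F x)^-1%g ⋆ fdiff h F x) => [|x].
    have dF := polymap_fdiff rF h; apply: polymapD => //.
    have := IHstar _ _ _ _ (IHinv _ _ (polymapWr rF)) dF.
    by apply: polymap_leq; rewrite addnS ltnS leq_addl.
  by rewrite -circ_quotient /circ mulVKg.
split=> [n F rF|m n F G rF rG].
  split=> [x|h]; first by apply: strong_pow_inv; apply: (polymap_val rF).
  have [E rE FE] := quot n F h rF.
  have -> : fdiff h (fun x => (F x)^-1%g) =
            fun x => (E x)^-1%g + (E x)^-1%g ⋆ (F x)^-1%g.
    apply/funext => x; rewrite /fdiff FE.
    have -> : ((F x ∘ E x)^-1)%g = (E x)^-1%g ∘ (F x)^-1%g.
      by rewrite /circ invgM.
    by rewrite circE addrAC addrK.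
  apply: polymapD; first exact: IHinv.
  have := IHstar _ _ _ _ (IHinv _ _ rE) (IHinv _ _ (polymapWr rF)).
  by apply: polymap_leq; rewrite leq_addr.
split=> [x|h].
  by apply: strong_pow_star; [apply: (polymap_val rF) | apply: (polymap_val rG)].
have [E rE FE] := quot m F h rF.
have rG' := polymapD (polymapWr rG) (polymapWn (polymap_fdiff rG h)).
have -> : fdiff h (fun x => F x ⋆ G x) = fun x =>
  F x ⋆ fdiff h G x + E x ⋆ (G x + fdiff h G x) +
  F x ⋆ (E x ⋆ (G x + fdiff h G x)).
  apply/funext => x; rewrite {1}/fdiff FE circ_starl fdiff_shift (starDr (F x) (G x)).
  move: (F x ⋆ G x) (F x ⋆ fdiff h G x) (E x ⋆ _) (F x ⋆ (E x ⋆ _)) => u v w z.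
  by rewrite addrC !addrA addNr add0r.
have rEG := IHstar _ _ _ _ rE rG'.
apply: polymapD; first apply: polymapD.
- by rewrite -addnS; apply: IHstar; [apply: polymapWr | apply: polymap_fdiff].
- exact: rEG.
have := IHstar _ _ _ _ (polymapWr rF) rEG.
by apply: polymap_leq; rewrite addSn leq_addl.
Qed.

Lemma polymap_deg_lt r n F :
  (forall a : A, strong_pow (n + r) a -> a = 0) -> polymap r n F -> deg_lt r F.
Proof.
elim: r n F => [|r IHr] n F F0 rF.
  by move=> x; apply: F0; rewrite addn0; apply: (polymap_val rF).
by move=> h; apply: (IHr n.+1); rewrite ?addSnnS //; apply: polymap_fdiff.
Qed.

End PolynomialMaps.

(** * The linear part of a polynomial map over a prime field *)

Section LinearPart.
Variables (p : nat) (p_prime : prime p).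
Implicit Types X V : lmodType 'F_p.

(** On a homogeneous map of degree [j] this is multiplication by
    [\sum_i 2^(i (j - 1))], so that it is minus the projection onto the
    component of degree 1, if the only degrees [j] present with
    [2^(j - 1) = 1] in ['F_p] are [j = 1]. *)
Definition lin_part X V (F : X -> V) (x : X) : V :=
  \sum_(0 <= i < p.-1) ((2 ^ i)%:R : 'F_p)^-1 *: F (x *+ 2 ^ i).

Lemma deg_ltZ X V d (q : 'F_p) (F : X -> V) :
  deg_lt d F -> deg_lt d (fun x => q *: F x).
Proof.
elim: d F => [F F0 x|d IHd F dF h]; first by rewrite F0 scaler0.
have -> : fdiff h (fun x => q *: F x) = fun x => q *: fdiff h F x.
  by apply/funext => x; rewrite /fdiff scalerBr.
exact: IHd.
Qed.

Lemma deg_lt_lin_part X V d (F : X -> V) :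
  deg_lt d F -> deg_lt d (lin_part F).
Proof.
by move=> dF; apply: deg_lt_sum => i; apply/deg_ltZ/deg_lt_dilate.
Qed.

Lemma morphD_scaler X V (f : X -> V) : {morph f : x y / x + y} ->
  forall (q : 'F_p) x, f (q *: x) = q *: f x.
Proof.
move=> fD q x; rewrite -[q]natr_Zp !scaler_nat; elim: (q : nat) => [|n IHn].
  by apply: (addrI (f 0)); rewrite -fD !addr0.
by rewrite !mulrS fD IHn.
Qed.

Lemma natr_exp2_neq0 i : (2 < p)%N -> (2 ^ i)%:R != 0 :> 'F_p.
Proof.
move=> p_gt2; rewrite natrX expf_neq0 //.
by rewrite -(dvdn_pcharf (pchar_Fp p_prime)) gtnNdvd.
Qed.

(** Doubling the argument shifts the summation index by 1, and the summands
    have period [p - 1] by Fermat's little theorem. *)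
Lemma lin_part_dilate2 X V (F : X -> V) x :
  (2 < p)%N -> lin_part F (x *+ 2) = lin_part F x *+ 2.
Proof.
move=> p_gt2; pose g i := ((2 ^ i)%:R : 'F_p)^-1 *: F (x *+ 2 ^ i).
have pm1 : (2 ^ p.-1)%:R = 1 :> 'F_p.
  apply: (mulfI (natr_exp2_neq0 1 p_gt2)).
  rewrite -natrM -expnD add1n prednK ?prime_gt0 // mulr1; apply: ord_inj.
  by rewrite !(val_Fp_nat p_prime) fermat_little.
have g_period : g p.-1 = g 0.
  by rewrite /g pm1 -scaler_nat pm1 scale1r expn0 mulr1n.
have -> : lin_part F (x *+ 2) = \sum_(0 <= i < p.-1) g i.+1 *+ 2.
  apply: eq_bigr => i _; rewrite /g -mulrnA -expnS -scaler_nat scalerA.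
  congr (_ *: _); rewrite expnS natrM invfM mulrA mulfV ?mul1r //.
  exact: (natr_exp2_neq0 1).
rewrite sumrMnl; congr (_ *+ 2); apply: (addrI (g 0)).
by rewrite -big_nat_recl // big_nat_recr //= g_period addrC.
Qed.

(** If [L] has degree at most [d], then [L (2 x) - 2^d L x = (2 - 2^d) L x] has
    degree less than [d]. As [2^d] is not 2 modulo [p] for [1 < d < k], this
    lowers the degree of [L] step by step until [L] is affine. *)
Lemma lin_part_additive X V k (F : X -> V) : (0 < k)%N -> (2 ^ k < p)%N ->
  deg_lt k F -> {morph lin_part F : x y / x + y}.
Proof.
move=> k_gt0 lt_2k_p dF; set L := lin_part F.
have p_gt2 : (2 < p)%N.
  by apply: leq_ltn_trans lt_2k_p; rewrite -{1}[2%N]expn1 leq_exp2l.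
have L2 x : L (x *+ 2) = L x *+ 2 by apply: lin_part_dilate2.
have L0 : L 0 = 0.
  by apply: (addrI (L 0)); rewrite addr0 -mulr2n -L2 mul0rn.
suff dL : deg_lt 2 L by move=> x y; apply: deg_lt2_additive.
have dkL : deg_lt k L by apply: deg_lt_lin_part.
have drop d : (1 < d < k)%N -> deg_lt d.+1 L -> deg_lt d L.
  case/andP=> d_gt1 lt_dk /deg_lt_dilate2 dL.
  pose q : 'F_p := 2%:R - (2 ^ d)%:R.
  have q_neq0 : q != 0.
    rewrite subr_eq0; apply/eqP => /(congr1 (fun z : 'F_p => z : nat)).
    rewrite !(val_Fp_nat p_prime) !modn_small //; last first.
      by apply: leq_ltn_trans lt_2k_p; rewrite leq_exp2l // ltnW.
    by rewrite -{1}[2%N]expn1 => /eqP; rewrite eqn_exp2l // ltn_eqF.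
  have -> : L = fun x => q^-1 *: (L (x *+ 2) - L x *+ 2 ^ d).
    apply/funext => x; rewrite L2 -!scaler_nat -scalerBl -/q.
    by rewrite scalerA mulVf // scale1r.
  exact: deg_ltZ.
case: k k_gt0 {lt_2k_p dF} dkL drop => [|[|k]] // _ dkL drop.
  exact: deg_ltW.
elim: k dkL drop => // k IHk dkL drop; apply: IHk.
  by apply: drop; rewrite ?ltnSn.
by move=> d /andP[d_gt1 lt_dk]; apply: drop; rewrite d_gt1 ltnW.
Qed.

End LinearPart.

(** * The associator of the product *)

Section PreLie.
Variables (p : nat) (p_prime : prime p) (k : nat) (lt_2k_p : (2 ^ k < p)%N).
Variables (A : fbraceType 'F_p) (A_nil : strongly_nilpotent_of_degree A k).
Implicit Types a b c : A.

Lemma polymap_lt_degree (X : zmodType) (F : X -> A) : polymap k 0 F -> deg_lt k F.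
Proof. by apply: polymap_deg_lt => a; case: A_nil => _ -> _. Qed.

Lemma lin_partD (X : lmodType 'F_p) (F : X -> A) :
  deg_lt k F -> {morph lin_part F : x y / x + y}.
Proof. by apply: lin_part_additive => //; case: A_nil. Qed.

(** A map that vanishes on both axes only has components of positive degree in
    each variable, hence of degree at least 2 on the diagonal. Formally,
    [lin_part B] is additive and [(x, x)] is the sum of [(x, 0)] and
    [(0, x)]. *)
Lemma lin_part_diag (X : lmodType 'F_p) (B : X * X -> A) : deg_lt k B ->
  (forall x, B (x, 0) = 0) -> (forall x, B (0, x) = 0) ->
  forall x, lin_part (fun y => B (y, y)) x = 0.
Proof.
move=> dB B10 B01 x.
have pairMn n (y z : X) : (y, z) *+ n = (y *+ n, z *+ n) :> X * X.
  by rewrite -!scaler_nat.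
transitivity (lin_part B (x, x)).
  by apply: eq_bigr => i _; rewrite pairMn.
have -> : (x, x) = (x, 0) + (0, x) :> X * X.
  by congr pair; rewrite /= ?addr0 ?add0r.
rewrite lin_partD // /lin_part !big1 ?addr0 // => i _;
  by rewrite pairMn mul0rn ?B10 ?B01 scaler0.
Qed.

Lemma lin_part_cst (X : lmodType 'F_p) a (x : X) : lin_part (fun=> a) x = 0.
Proof.
have dC : deg_lt k (fun _ : X => a).
  by apply: polymap_lt_degree; apply: polymap_cst; apply: strong_pow_full.
by apply: (addrI (lin_part (fun=> a) x)); rewrite addr0 -lin_partD.
Qed.

Lemma polymap_star (X : zmodType) (F G : X -> A) :
  polymap k 0 F -> polymap k 0 G -> polymap k 0 (fun x => F x ⋆ G x).
Proof. by case: (polymap_inv_star A X k) => _; apply. Qed.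

Lemma polymap_full_cst (X : zmodType) a : polymap k 0 (fun _ : X => a).
Proof. by apply: polymap_cst; apply: strong_pow_full. Qed.

(** Up to sign, the derivative of [z |-> z ⋆ c] at [x] in the direction [y]. *)
Definition dstar c (x y : A) := lin_part (fun z : A => (x + z) ⋆ c) y.

Lemma dstarD c (x : A) : {morph dstar c x : y z / y + z}.
Proof.
apply/lin_partD/polymap_lt_degree/polymap_star/polymap_full_cst.
by apply: polymapD (polymap_full_cst _ x) _; apply: polymap_additive.
Qed.

Lemma dstar0 c (y : A) : dstar c 0 y = y ⊙ c.
Proof. by apply: eq_bigr => i _; rewrite add0r. Qed.

(** Both sides are the double sum that takes out of [(s a + t b) ⋆ c] the
    component of degree 1 in [s] and in [t]. *)
Lemma dstarC c a b :
  lin_part (fun x => dstar c x b) a = lin_part (fun x => dstar c x a) b.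
Proof.
rewrite /dstar /lin_part; under eq_bigr do rewrite scaler_sumr.
under [RHS]eq_bigr do rewrite scaler_sumr.
rewrite exchange_big; apply: eq_bigr => i _; apply: eq_bigr => j _.
by rewrite !scalerA mulrC addrC.
Qed.

(** The linear part in [y], at [b], of [circ_starl] applied to [x], [y] and [c]:
    here [x ∘ y] is [x] plus [y + x ⋆ y], which is additive in [y]. *)
Lemma dstar_circ c b (x : A) :
  dstar c x b + dstar c x (x ⋆ b) = b ⊙ c + x ⋆ (b ⊙ c).
Proof.
rewrite -dstarD -[RHS]add0r -(lin_part_cst (x ⋆ c) b).
rewrite /dstar /prelie_mul /lin_part.
have -> q : x ⋆ (\sum_(0 <= i < q) ((2 ^ i)%:R : 'F_p)^-1 *: (b *+ 2 ^ i ⋆ c)) =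
  \sum_(0 <= i < q) ((2 ^ i)%:R : 'F_p)^-1 *: (x ⋆ (b *+ 2 ^ i ⋆ c)).
  elim: q => [|q IHq]; first by rewrite !big_nil star0r.
  by rewrite !big_nat_recr //= starDr IHq brace_scaler.
rewrite -!big_split /=; apply: eq_bigr => i _.
rewrite -!scalerDr; congr (_ *: _).
by rewrite [RHS]addrA -circ_starl circE mulrnDl starMnr -[in RHS]addrA.
Qed.

(** With [0] in place of the base point [x], the claim is the additivity of
    [y |-> y ⊙ c]. The base point may be replaced, because
    [dstar c x y - dstar c 0 y] at [y = x' ⋆ b] vanishes both for [x = 0] and
    for [x' = 0]. *)
Lemma lin_part_dstar c a b :
  lin_part (fun x => dstar c x (x ⋆ b)) a = (a ⊙ b) ⊙ c.
Proof.
pose B (z : A * A) := dstar c z.1 (z.2 ⋆ b) - dstar c 0 (z.2 ⋆ b).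
have dB : deg_lt k B.
  (* [B] is a combination of maps built with [⋆], one for each power of 2. *)
  have -> : B = fun z => \sum_(0 <= i < p.-1) ((2 ^ i)%:R : 'F_p)^-1 *:
    ((z.1 + (z.2 ⋆ b) *+ 2 ^ i) ⋆ c - (0 + (z.2 ⋆ b) *+ 2 ^ i) ⋆ c).
    apply/funext => z; rewrite /B /dstar /lin_part -sumrB.
    by apply: eq_bigr => i _; rewrite -scalerBr.
  apply: deg_lt_sum => i; apply/deg_ltZ/polymap_lt_degree.
  have fstP : polymap k 0 (fun z : A * A => z.1) by apply: polymap_additive.
  have sndbP : polymap k 0 (fun z : A * A => (z.2 ⋆ b) *+ 2 ^ i).
    apply/polymapMn/polymap_star/polymap_full_cst.
    by apply: polymap_additive.
  apply: polymapD; last apply: polymapN.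
    by apply/polymap_star/polymap_full_cst; apply: polymapD.
  apply/polymap_star/polymap_full_cst.
  by apply: polymapD => //; apply: polymap_full_cst.
have B10 x : B (x, 0) = 0.
  rewrite /B /= star0l.
  have d0 y : dstar c y 0 = 0.
    by apply: (addrI (dstar c y 0)); rewrite -dstarD !addr0.
  by rewrite !d0 subrr.
have B01 x : B (0, x) = 0 by rewrite /B /= subrr.
have dstar0Z := morphD_scaler (dstarD c 0).
have dstar00 : dstar c 0 0 = 0.
  by rewrite -[X in dstar c 0 X](scale0r 0) dstar0Z scale0r.
have -> : (a ⊙ b) ⊙ c = lin_part (fun x => dstar c 0 (x ⋆ b)) a.
  rewrite -dstar0 /prelie_mul /lin_part (big_morph _ (dstarD c 0) dstar00).
  by apply: eq_bigr => i _; rewrite dstar0Z.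
apply/subr0_eq; rewrite -[RHS](lin_part_diag dB B10 B01 a) /lin_part -sumrB.
by apply: eq_bigr => i _; rewrite -scalerBr.
Qed.

(** The linear part in [x], at [a], of [dstar_circ]. *)
Lemma associator_dstar a b c :
  (a ⊙ b) ⊙ c - a ⊙ (b ⊙ c) = - lin_part (fun x => dstar c x b) a.
Proof.
apply/eqP; rewrite subr_eq addrC; apply/eqP.
rewrite -lin_part_dstar; apply: (addrI (lin_part (fun x => dstar c x b) a)).
rewrite addrCA subrr addr0.
rewrite -[RHS]add0r -(lin_part_cst (b ⊙ c) a) /lin_part -!big_split /=.
apply: eq_bigr => i _; rewrite -!scalerDr; congr (_ *: _).
exact: dstar_circ.
Qed.

End PreLie.

Theorem theorem5 (p : nat) (p_prime : prime p) (k : nat) (lt_2k_p : (2 ^ k < p)%N)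
    (A : fbraceType 'F_p) (A_nil : strongly_nilpotent_of_degree A k) (a b c : A) :
  (a ⊙ b) ⊙ c - a ⊙ (b ⊙ c) = (b ⊙ a) ⊙ c - b ⊙ (a ⊙ c).
Proof.
by rewrite !(associator_dstar p_prime lt_2k_p A_nil) dstarC.
Qed.
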